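(* Let $0<p<1$ and $0<r\le p$, and let $c_{p,r}>0$ be defined by $$c_{p,r}^{-1}=(2-p+r)\Big(\frac{1-p}{1-p+2r}\Big)^{1-p}.$$ Then for every sequence $(a_n)_{n\ge 1}$ with $a_n\ge 0$ for all $n$, $$\sum_{n=1}^{\infty}\frac{1}{n^r}\Big(\sum_{k=n}^{\infty}a_k\Big)^p\ \ge\ c_{p,r}\sum_{n=1}^{\infty}\frac{a_n^p}{n^{r-p}} .$$
   Context: All sums have nonnegative terms and take values in $[0,+\infty]$, with $(+\infty)^p=+\infty$ for $p>0$. *)

(* Defs.v *)
From mathcomp Require Import all_boot all_order all_algebra.
From mathcomp Require Import all_classical all_reals all_analysis.

Set Implicit Arguments.
Unset Strict Implicit.
Unset Printing Implicit Defensive.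

Import Order.TTheory GRing.Theory Num.Theory.

Local Open Scope ring_scope.

Definition c_pr (R : realType) (p r : R) : R :=
  ((2 - p + r) * ((1 - p) / (1 - p + 2 * r)) `^ (1 - p))^-1.

(* Main.v *)
(* Let A_n be the n-th tail sum and q = 1 - p. It suffices to find weights
   s_n >= 0 with s_0 = 0 and, for 0 <= B <= A,
     n^(p-r) (A - B)^p + s_n B^p <= (C n^-r + s_(n-1)) A^p,   C = 1 / c_{p,r},
   because these inequalities telescope for A = A_n, B = A_(n+1). Weights
   s_n = n^(p-r) ((n + d) / k)^q with k = (q + 2r) / q have the right growth:
   - if p >= 1/2, the shift d = 0 works;
   - if p < 1/2 and (1-p)^2 <= r (1+p), the shift d = -1/5 works; there p >= 1/3;
   - otherwise let p0 > p be the solution of (1-p0)^2 = r (1+p0), where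
     C = ((1-r)/p0)^p0. Applying the inequality for p0 to A^(p/p0) and using
     Young's inequality gives the constant ((1-r)/p)^p for p, and this is at most
     C by AM-GM. *)

Require Import Defs.
From mathcomp Require Import all_boot all_order all_algebra.
From mathcomp Require Import all_classical all_reals all_analysis.
From mathcomp Require Import ring lra.

Import Order.TTheory GRing.Theory Num.Theory.

Local Open Scope ring_scope.

(** * Weighted AM-GM, Bernoulli and Hölder inequalities for real powers *)

(** After division by the weighted mean [M], the tangent bound ln z <= z - 1 controls each factor,
    and the resulting exponents sum to 0. *)
Lemma powR_amgm3 (R : realType) (u v w a b c : R) :
  0 < u -> 0 < v -> 0 < w -> 0 <= a -> 0 <= b -> 0 <= c -> a + b + c = 1 ->
  u `^ a * v `^ b * w `^ c <= a * u + b * v + c * w.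
Proof.
move=> u0 v0 w0 a0 b0 c0 abc; set M := _ + _ + _.
have M0 : 0 < M.
  have [a1|a1] := ltP 0 a; first by rewrite /M; nra.
  have [b1|b1] := ltP 0 b; first by rewrite /M; nra.
  by rewrite /M; nra.
have tangent (x y : R) : 0 < x -> 0 <= y -> (x / M) `^ y <= expR (y * (x / M - 1)).
  move=> x0 y0; have xM : 0 < x / M by rewrite divr_gt0.
  rewrite /powR gt_eqF// ler_expR ler_wpM2l//.
  have -> : x / M = 1 + (x / M - 1) by ring.
  by rewrite [leRHS](_ : _ = x / M - 1) ?le_ln1Dx//; lra.
have split (x y : R) : 0 < x -> x `^ y = (x / M) `^ y * M `^ y.
  move=> x0; rewrite -powRM ?ltW ?divr_gt0//; congr (_ `^ _).
  by rewrite divfK// gt_eqF.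
rewrite (split u a)// (split v b)// (split w c)//.
have -> : (u / M) `^ a * M `^ a * ((v / M) `^ b * M `^ b) * ((w / M) `^ c * M `^ c)
    = (u / M) `^ a * (v / M) `^ b * (w / M) `^ c * (M `^ a * M `^ b * M `^ c).
  by ring.
have -> : M `^ a * M `^ b * M `^ c = M.
  have Mn0 : M != 0 by rewrite gt_eqF.
  by rewrite -powRD ?Mn0 ?implybT// -powRD ?Mn0 ?implybT// abc powRr1// ltW.
rewrite -[leRHS]mul1r ler_wpM2r ?(ltW M0)//.
apply: (@le_trans _ _ (expR (a * (u / M - 1)) * expR (b * (v / M - 1)) *
    expR (c * (w / M - 1)))).
  by rewrite !ler_pM ?mulr_ge0 ?powR_ge0// tangent.
rewrite -!expRD -[leRHS]expR0 ler_expR.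
have -> : a * (u / M - 1) + b * (v / M - 1) + c * (w / M - 1) = M / M - (a + b + c).
  by rewrite {4}/M; field; rewrite gt_eqF.
by rewrite divff ?gt_eqF// abc subrr.
Qed.

Lemma powR_amgm2 (R : realType) (u v a b : R) :
  0 <= u -> 0 <= v -> 0 < a -> 0 < b -> a + b = 1 ->
  u `^ a * v `^ b <= a * u + b * v.
Proof.
move=> u0 v0 a0 b0 ab.
have [->|un0] := eqVneq u 0; first by rewrite powR0 ?gt_eqF// mul0r; nra.
have [->|vn0] := eqVneq v 0; first by rewrite (powR0 (x:=b)) ?gt_eqF// mulr0; nra.
have up : 0 < u by rewrite lt_def un0.
have vp : 0 < v by rewrite lt_def vn0.
have := @powR_amgm3 _ u v 1 a b 0 up vp ltr01 (ltW a0) (ltW b0) (lexx 0).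
by rewrite powRr0 mulr1 mul0r !addr0; apply.
Qed.

Lemma powR_bernoulli_le (R : realType) (x s : R) : 0 < x -> 0 <= s <= 1 ->
  x `^ s <= 1 + s * (x - 1).
Proof.
move=> x0 /andP[s0 s1].
have := @powR_amgm3 _ x 1 1 s (1 - s) 0 x0 ltr01 ltr01 s0.
rewrite !powR1 !mulr1 => /(_ _ _ _)/le_trans; apply; lra.
Qed.

(** The concave case, applied to x^s with exponent 1/s. *)
Lemma powR_bernoulli_ge (R : realType) (x s : R) : 0 < x -> 1 <= s ->
  1 + s * (x - 1) <= x `^ s.
Proof.
move=> x0 s1; have s0 : 0 < s by lra.
have s1' : 0 <= s^-1 <= 1 by rewrite invr_ge0 ltW//= invf_le1.
have := @powR_bernoulli_le _ _ _ (powR_gt0 s x0) s1'.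
rewrite -powRrM divff ?gt_eqF// powRr1 ?(ltW x0)// => H.
have : s * x <= s * (1 + s^-1 * (x `^ s - 1)) by rewrite ler_wpM2l// (ltW s0).
by rewrite mulrDr mulrA divff ?gt_eqF//; lra.
Qed.

Lemma powR_ge1Dln (R : realType) (x s : R) : 0 < x -> 1 + s * ln x <= x `^ s.
Proof. by move=> x0; rewrite /powR gt_eqF// expR_ge1Dx. Qed.

Lemma ln_ge1BV (R : realType) (x : R) : 0 < x -> 1 - x^-1 <= ln x.
Proof.
move=> x0; have x10 : 0 < x^-1 by rewrite invr_gt0.
have := @le_ln1Dx _ (x^-1 - 1); rewrite addrCA subrr addr0 lnV// => /(_ _).
by move=> H; have := H ltac:(lra); lra.
Qed.

Lemma ln_leB1 (R : realType) (x : R) : 0 < x -> ln x <= x - 1.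
Proof.
by move=> x0; have := @le_ln1Dx _ (x - 1); rewrite addrCA subrr addr0; apply; lra.
Qed.

(** AM-GM for the normalized pairs x/(x+y), 1/(1+w) and y/(x+y), w/(1+w); the two bounds add up to p
    + q = 1. *)
Lemma powR_holder (R : realType) (p q x y w : R) :
  0 < p -> 0 < q -> p + q = 1 -> 0 <= x -> 0 <= y -> 0 <= w ->
  x `^ p + w `^ q * y `^ p <= (1 + w) `^ q * (x + y) `^ p.
Proof.
move=> p0 q0 pq x0 y0 w0.
have [xy0|xyn0] := eqVneq (x + y) 0.
  have -> : x = 0 by lra.
  have -> : y = 0 by lra.
  by rewrite addr0 powR0 ?gt_eqF// !mulr0 addr0.
have xy : 0 < x + y by rewrite lt_def xyn0 addr_ge0.
have w1 : 0 < 1 + w by lra.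
have split (a b : R) : 0 <= a -> 0 <= b ->
    b `^ q * a `^ p = ((1 + w) `^ q * (x + y) `^ p) * ((a / (x + y)) `^ p * (b / (1 + w)) `^ q).
  move=> a0 b0.
  rewrite [RHS](_ : _ = ((1 + w) `^ q * (b / (1 + w)) `^ q) *
     ((x + y) `^ p * (a / (x + y)) `^ p)); last by ring.
  rewrite -!powRM ?divr_ge0 ?(ltW w1) ?(ltW xy)//.
  by rewrite !(mulrC _ (_ / _)) !divfK ?gt_eqF// mulrC.
have := split x 1 x0 ler01; rewrite powR1 mul1r => ->.
rewrite (split y w)// -mulrDr -[leRHS]mulr1 ler_wpM2l ?mulr_ge0 ?powR_ge0//.
apply: le_trans (lerD (powR_amgm2 _ _ _ _ _ _ _ p0 q0 pq)
  (powR_amgm2 _ _ _ _ _ _ _ p0 q0 pq)) _;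
  rewrite ?divr_ge0 ?(ltW w1) ?(ltW xy)//.
rewrite [leLHS](_ : _ = p * ((x + y) / (x + y)) + q * ((1 + w) / (1 + w))); last by ring.
by rewrite !divff ?gt_eqF// !mulr1 pq.
Qed.

Lemma powR_div (R : realType) (a b s : R) : 0 <= a -> 0 < b ->
  (a / b) `^ s = a `^ s / b `^ s.
Proof.
move=> a0 b0; apply/(canRL (mulfK _)); first by rewrite gt_eqF// powR_gt0.
by rewrite -powRM ?divfK ?gt_eqF// ?divr_ge0// ltW.
Qed.

(** * The constant and the telescoping weights *)

Lemma c_pr_gt0 (R : realType) (p r : R) : p < 1 -> 0 < r -> 0 < c_pr p r.
Proof.
move=> p1 r0; rewrite invr_gt0 mulr_gt0 ?powR_gt0 ?divr_gt0//; lra.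
Qed.

Lemma c_pr_invE (R : realType) (p r : R) : p < 1 -> 0 < r ->
  (c_pr p r)^-1 = (2 - p + r) / ((1 - p + 2 * r) / (1 - p)) `^ (1 - p).
Proof.
move=> p1 r0; rewrite /c_pr invrK; congr (_ * _).
have q0 : 0 < 1 - p by lra.
have k0 : 0 < 1 - p + 2 * r by lra.
by rewrite !powR_div ?invf_div ?(ltW q0) ?(ltW k0).
Qed.

(* One step of a telescoping proof: with A and B two consecutive tail sums,
   A - B is the term a_(n+1), and summing over n cancels the s's. *)
Definition hardy_step {R : realType} (p r C : R) : Prop :=
  exists2 s : nat -> R, (forall n, 0 <= s n) /\ s 0%N = 0 &
    forall n (A B : R), 0 <= B -> B <= A ->
      n.+1%:R `^ (p - r) * (A - B) `^ p + s n.+1 * B `^ p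
        <= (C / n.+1%:R `^ r + s n) * A `^ p.

(* Take s_n = n^(p-r) ((n+d)/k)^(1-p): maximizing over B / A by Hoelder's
   inequality leaves a condition on n alone. *)
Lemma hardy_step_shift (R : realType) (p r d : R) (k := (1 - p + 2 * r) / (1 - p)) :
  0 < p -> p < 1 -> 0 < r -> -1 <= d ->
  (k + 1 + d) `^ (1 - p) <= 2 - p + r ->
  (forall n, n.+2%:R `^ p * (k + n.+2%:R + d) `^ (1 - p) <=
     2 - p + r + n.+2%:R `^ r * n.+1%:R `^ (p - r) * (n.+1%:R + d) `^ (1 - p)) ->
  hardy_step p r (c_pr p r)^-1.
Proof.
move=> p0 p1 r0 d1 first rec.
have q0 : 0 < 1 - p by lra.
have k0 : 0 < k by rewrite divr_gt0//; lra.
have kq0 : 0 < k `^ (1 - p) by rewrite powR_gt0.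
have nd n : 0 <= n.+1%:R + d.
  by have : (1:R) <= n.+1%:R by [rewrite ler1n]; lra.
(* The case split imposes s_0 = 0: the formula need not vanish at 0 when d < 0 and p = r. *)
exists (fun n => if n is m.+1 then m.+1%:R `^ (p - r) * ((m.+1%:R + d) / k) `^ (1 - p) else 0).
  by split=> // -[|n]//; rewrite mulr_ge0 ?powR_ge0.
move=> n A B B0 BA.
have AB0 : 0 <= A - B by lra.
have w0 : 0 <= (n.+1%:R + d) / k by rewrite divr_ge0// ltW.
(* With this w, the factor (n+1)^(p-r) w^(1-p) in Hölder's inequality is the weight s_(n+1). *)
have := powR_holder _ _ _ _ _ _ p0 q0 (subrKC p 1) AB0 B0 w0.
have -> : A - B + B = A by ring.
move=> /(ler_wpM2l (powR_ge0 n.+1%:R (p - r))) H.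
rewrite -mulrA -mulrDr; apply: le_trans H _.
rewrite mulrA ler_wpM2r ?powR_ge0//.
have Nr : 0 < n.+1%:R `^ r :> R by rewrite powR_gt0.
have -> : 1 + (n.+1%:R + d) / k = (k + n.+1%:R + d) / k by field; rewrite gt_eqF.
rewrite powR_div//; last by have := nd n; lra.
rewrite powRB ?pnatr_eq0 ?implybT// c_pr_invE// -/k.
rewrite [leLHS](_ : _ = (n.+1%:R `^ p * (k + n.+1%:R + d) `^ (1 - p)) /
   (n.+1%:R `^ r * k `^ (1 - p))); last by field; rewrite !gt_eqF.
rewrite ler_pdivrMr ?mulr_gt0//.
(* With denominators cleared, n = 0 is [first] and the later indices are [rec]. *)
case: n {w0} Nr => [|n] Nr.
  rewrite !powR1 mul1r divr1 addr0 mul1r divfK ?gt_eqF//.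
apply: le_trans (rec n) _; rewrite powR_div//.
by rewrite le_eqVlt; apply/orP; left; apply/eqP; field; rewrite !gt_eqF.
Qed.

(** * The case p >= 1/2, without shift *)

(** Rational bounds [upper] and [lower] replace both sides of the condition at N = M + 1; what
    remains is r M (1/(N-r) - 1/(N+1)) >= 0. *)
Lemma hardy_step_half (R : realType) (p r : R) :
  2^-1 <= p -> p < 1 -> 0 < r -> r <= p -> hardy_step p r (c_pr p r)^-1.
Proof.
move=> p2 p1 r0 rp.
have p0 : 0 < p by lra.
have q0 : 0 < 1 - p by lra.
set k := (1 - p + 2 * r) / (1 - p).
have kE : (1 - p) * k = 1 - p + 2 * r by rewrite /k; field; rewrite gt_eqF.
have k0 : 0 < k by rewrite divr_gt0//; lra.
have upper (N : R) : 1 <= N ->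
    N `^ p * (k + N) `^ (1 - p) <= N + (1 - p) + 2 * r * N / (N + 1).
  move=> N1; have N0 : 0 < N by lra.
  have N10 : 0 < N + 1 by lra.
  have kN : 0 < k + N by lra.
  (* AM-GM for N (k + N) / (N + 1), N + 1 and N with weights q, q and 1 - 2q,
     where q = 1 - p; this is where p >= 1/2 is used. *)
  have U0 : 0 < N * (k + N) / (N + 1) by rewrite divr_gt0// mulr_gt0.
  have -> : N `^ p * (k + N) `^ (1 - p) =
      (N * (k + N) / (N + 1)) `^ (1 - p) * (N + 1) `^ (1 - p) * N `^ (2 * p - 1).
    rewrite -powRM ?(ltW U0) ?(ltW N10)// divfK ?gt_eqF//.
    rewrite powRM ?(ltW N0) ?(ltW kN)// mulrAC -powRD ?(gt_eqF N0) ?implybT//.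
    by congr (_ `^ _ * _); ring.
  apply: le_trans (powR_amgm3 _ _ _ _ _ _ _ U0 N10 N0 _ _ _ _) _; try lra.
  rewrite le_eqVlt; apply/orP; left; apply/eqP.
  have -> : (1 - p) * (N * (k + N) / (N + 1)) = N * ((1 - p) * k + (1 - p) * N) / (N + 1).
    by ring.
  by rewrite kE; field; rewrite gt_eqF.
apply: (@hardy_step_shift R p r 0) => //; rewrite -/k.
  (* At N = 1 the right side of [upper] is exactly 2 - p + r. *)
  have := upper 1 (lexx _); rewrite powR1 mul1r addr0 => /le_trans; apply.
  have -> : 2 * r * 1 / (1 + 1) = r by field.
  by lra.
move=> n; rewrite !addr0 -mulrA -powRD ?pnatr_eq0 ?implybT//.
set N := n.+2%:R; set M := n.+1%:R.
have NE : N = M + 1 by rewrite /N -natr1.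
have M1 : 1 <= M by rewrite ler1n.
clearbody N M.
have M0 : 0 < M by lra.
have N0 : 0 < N by lra.
have -> : p - r + (1 - p) = 1 - r by ring.
apply: le_trans (upper N _) _; first lra.
(* AM-GM bounds the complementary product M^r N^(1-r) by r M + (1-r) N = N - r. *)
have lower : M * N <= (N - r) * (N `^ r * M `^ (1 - r)).
  have -> : M * N = (N `^ r * M `^ (1 - r)) * (M `^ r * N `^ (1 - r)).
    rewrite [RHS](_ : _ = (M `^ (1 - r) * M `^ r) * (N `^ r * N `^ (1 - r))); last by ring.
    rewrite -!powRD ?(gt_eqF M0) ?(gt_eqF N0) ?implybT//.
    have -> : 1 - r + r = 1 by ring.
    have -> : r + (1 - r) = 1 by ring.
    by rewrite !powRr1 ?ltW.
  rewrite [leLHS]mulrC ler_wpM2r ?mulr_ge0 ?powR_ge0//.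
  apply: le_trans (powR_amgm2 _ _ _ _ _ (ltW M0) (ltW N0) r0 _ _) _; rewrite ?NE; lra.
have Nr0 : 0 < N - r by lra.
have {lower} : M * N / (N - r) <= N `^ r * M `^ (1 - r) by rewrite ler_pdivrMr// [leRHS]mulrC.
have -> : M * N / (N - r) = M + r * M / (N - r) by field; rewrite gt_eqF.
have -> : 2 * r * N / (N + 1) = r + r * M / (N + 1).
  by rewrite NE; field; rewrite gt_eqF//; lra.
have : r * M / (N + 1) <= r * M / (N - r).
  by rewrite ler_wpM2l ?(mulr_ge0 (ltW r0) (ltW M0))// lef_pV2 ?posrE//; lra.
by rewrite [X in X + (1 - p)]NE; lra.
Qed.

(** * The case p <= 1/2 with shift -1/5 *)

Lemma mulr_exp_ge (R : realType) (t T c k : R) n :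
  0 <= t <= T -> 0 <= k -> - k <= c -> - (k * T ^+ n) <= c * t ^+ n.
Proof.
move=> /andP[t0 tT] k0 kc.
have tn0 : 0 <= t ^+ n by rewrite exprn_ge0.
have tn : t ^+ n <= T ^+ n by rewrite lerXn2r ?nnegrE//; exact: le_trans tT.
by nra.
Qed.

(* The next two polynomials in t come from the difference of the two sides of
   [shift_poly_le]: once divided by t^2, it is the second one plus
   m - u^2 times the first one. *)
Lemma shift_poly_cofactor_ge0 (R : realType) (t u : R) :
  0 <= t <= 13 / 50 -> 0 <= u <= 1 / 6 ->
  0 <= (9 / 5 + 54 / 5 * u)
    + (- (5 / 8) + 207 / 16 * u + 27 * u ^+ 2) * t ^+ 1
    + (- (51 / 40) - 207 / 80 * u + 54 * u ^+ 2) * t ^+ 2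
    + (- (49 / 40) - 573 / 80 * u + 36 * u ^+ 2) * t ^+ 3
    + (- (21 / 40) - 177 / 80 * u + 9 * u ^+ 2) * t ^+ 4
    + (- (7 / 40) + 21 / 80 * u) * t ^+ 5
    + (- (1 / 40) + 3 / 80 * u) * t ^+ 6.
Proof.
move=> t01 /andP[u0 uU]; have u2 : 0 <= u ^+ 2 by exact: sqr_ge0.
(* Each coefficient is bounded below by a constant on 0 <= u <= 1/6; putting t = 13/50 in the
   negative terms leaves a numerical inequality. *)
have b0 : 9 / 5 <= 9 / 5 + 54 / 5 * u by lra.
have b1 : - 1 <= - (5 / 8) + 207 / 16 * u + 27 * u ^+ 2 by lra.
have b2 : - 2 <= - (51 / 40) - 207 / 80 * u + 54 * u ^+ 2 by lra.
have b3 : - 3 <= - (49 / 40) - 573 / 80 * u + 36 * u ^+ 2 by lra.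
have b4 : - 1 <= - (21 / 40) - 177 / 80 * u + 9 * u ^+ 2 by lra.
have b5 : - 1 <= - (7 / 40) + 21 / 80 * u by lra.
have b6 : - 1 <= - (1 / 40) + 3 / 80 * u by lra.
apply: le_trans (lerD (lerD (lerD (lerD (lerD (lerD b0
  (mulr_exp_ge _ _ _ _ _ 1 t01 _ b1)) (mulr_exp_ge _ _ _ _ _ 2 t01 _ b2))
  (mulr_exp_ge _ _ _ _ _ 3 t01 _ b3)) (mulr_exp_ge _ _ _ _ _ 4 t01 _ b4))
  (mulr_exp_ge _ _ _ _ _ 5 t01 _ b5)) (mulr_exp_ge _ _ _ _ _ 6 t01 _ b6)) => //.
by clear; rewrite !exprS expr0; lra.
Qed.

Lemma shift_poly_main_ge0 (R : realType) (t u : R) :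
  0 <= t <= 13 / 50 -> 0 <= u <= 1 / 6 ->
  0 <= (9 / 8 + 249 / 80 * u - 189 / 10 * u ^+ 2 + 54 / 5 * u ^+ 3)
    + (- (13 / 6) - 647 / 160 * u + (31 + 221 / 320) * u ^+ 2
         - 765 / 16 * u ^+ 3 + 27 * u ^+ 4) * t ^+ 1
    + (- (25 / 6) - 1051 / 40 * u + (118 + 31 / 80) * u ^+ 2
         - (124 + 7 / 80) * u ^+ 3 + 54 * u ^+ 4) * t ^+ 2
    + (- (31 / 12) - 89 / 4 * u + (89 + 57 / 80) * u ^+ 2
         - (88 + 13 / 80) * u ^+ 3 + 36 * u ^+ 4) * t ^+ 3
    + (- (17 / 30) - 497 / 80 * u + (23 + 91 / 160) * u ^+ 2
         - 1797 / 80 * u ^+ 3 + 9 * u ^+ 4) * t ^+ 4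
    + (- (1 / 15) + 11 / 40 * u - 7 / 16 * u ^+ 2 + 21 / 80 * u ^+ 3) * t ^+ 5
    + (- (1 / 120) + 1 / 16 * u - 1 / 10 * u ^+ 2 + 3 / 80 * u ^+ 3) * t ^+ 6
    + (1 / 160 * u - 3 / 320 * u ^+ 2) * t ^+ 7.
Proof.
move=> t01 /andP[u0 uU].
have u2 : 0 <= u ^+ 2 <= u / 6 by apply/andP; split; nra.
have u3 : 0 <= u ^+ 3 <= u ^+ 2 / 6 by rewrite exprS; apply/andP; split; nra.
have u4 : 0 <= u ^+ 4 by rewrite exprn_ge0.
(* Tangent lines to u^2 at 1/12 and 1/7 make the coefficient bounds accessible to linear
   arithmetic. *)
have ua : u / 6 - 1 / 144 <= u ^+ 2 by have := sqr_ge0 (u - 1 / 12); lra.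
have ub : 2 / 7 * u - 1 / 49 <= u ^+ 2 by have := sqr_ge0 (u - 1 / 7); lra.
have b0 : 111 / 100 <= 9 / 8 + 249 / 80 * u - 189 / 10 * u ^+ 2 + 54 / 5 * u ^+ 3.
  by lra.
have b1 : - (235 / 100) <= - (13 / 6) - 647 / 160 * u + (31 + 221 / 320) * u ^+ 2
    - 765 / 16 * u ^+ 3 + 27 * u ^+ 4 by lra.
have b2 : - (61 / 10) <= - (25 / 6) - 1051 / 40 * u + (118 + 31 / 80) * u ^+ 2
    - (124 + 7 / 80) * u ^+ 3 + 54 * u ^+ 4 by lra.
have b3 : - (43 / 10) <= - (31 / 12) - 89 / 4 * u + (89 + 57 / 80) * u ^+ 2
    - (88 + 13 / 80) * u ^+ 3 + 36 * u ^+ 4 by lra.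
have b4 : - (11 / 10) <= - (17 / 30) - 497 / 80 * u + (23 + 91 / 160) * u ^+ 2
    - 1797 / 80 * u ^+ 3 + 9 * u ^+ 4 by lra.
have b5 : - (1 / 10) <= - (1 / 15) + 11 / 40 * u - 7 / 16 * u ^+ 2 + 21 / 80 * u ^+ 3.
  by lra.
have b6 : - (1 / 10) <= - (1 / 120) + 1 / 16 * u - 1 / 10 * u ^+ 2 + 3 / 80 * u ^+ 3.
  by lra.
have b7 : - 0 <= 1 / 160 * u - 3 / 320 * u ^+ 2 by lra.
apply: le_trans (lerD (lerD (lerD (lerD (lerD (lerD (lerD b0
  (mulr_exp_ge _ _ _ _ _ 1 t01 _ b1)) (mulr_exp_ge _ _ _ _ _ 2 t01 _ b2))
  (mulr_exp_ge _ _ _ _ _ 3 t01 _ b3)) (mulr_exp_ge _ _ _ _ _ 4 t01 _ b4))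
  (mulr_exp_ge _ _ _ _ _ 5 t01 _ b5)) (mulr_exp_ge _ _ _ _ _ 6 t01 _ b6))
  (mulr_exp_ge _ _ _ _ _ 7 t01 _ b7)); clear; lra.
Qed.

(** Here [a], [b] and the last factor are lower bounds for h^(3p), (1 - x/5)^q and h^(3(p+r)); the
    left side is an AM-GM upper bound. *)
Lemma shift_poly_le (R : realType) (t u m : R)
    (h := 1 + t) (x := h ^+ 3 - 1) (q := 2 / 3 - u)
    (a := h * (1 + 3 * u * t * (1 - (1 - 3 * u) * t)))
    (b := 1 - q * (x / 5 + x ^+ 2 / 80)) :
  0 <= t <= 13 / 50 -> 0 <= u <= 1 / 6 -> u ^+ 2 <= m ->
  1 / 3 + u + 2 * (1 / 3 + u) * x + (1 / 3 + u) * x ^+ 2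
    + (q + (9 / 5 * q + 2 * (1 / 3 - 5 / 4 * u + m)) * x) <=
  (2 - 9 / 4 * u + m) * x * a + b * (h ^+ 2 - 3 / 4 * u * h ^+ 2 * t + 3 * m * h * t).
Proof.
move=> t01 u01 mU; have G0 := shift_poly_main_ge0 _ _ _ t01 u01.
have E0 := shift_poly_cofactor_ge0 _ _ _ t01 u01.
have H := addr_ge0 (mulr_ge0 (sqr_ge0 t) G0) (mulr_ge0 (_ : 0 <= m - u ^+ 2) (mulr_ge0 (sqr_ge0 t) E0)).
rewrite -subr_ge0; apply: le_trans (H _) _; first by rewrite subr_ge0.
rewrite le_eqVlt; apply/orP; left; apply/eqP.
by rewrite /a /b /q /x /h; clear; field.
Qed.

(** Bernoulli with exponent 2q >= 1, after bounding the square root of 1 - z from below. As 5/16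
    exceeds 1/4, squaring leaves a slack z^2/16 that absorbs the higher terms. *)
Lemma powR_oneB_ge (R : realType) (z q : R) : 0 <= z <= 1 / 5 -> 1 / 2 <= q ->
  1 - q * (z + 5 / 16 * z ^+ 2) <= (1 - z) `^ q.
Proof.
move=> /andP[z0 z1] q2.
have w0 : 0 < 1 - (z + 5 / 16 * z ^+ 2) / 2 by nra.
have wz : (1 - (z + 5 / 16 * z ^+ 2) / 2) `^ 2%:R <= 1 - z.
  rewrite powR_mulrn ?(ltW w0)//.
  have c0 : 0 <= 1 / 16 - 5 / 32 * z - (5 / 32) ^+ 2 * z ^+ 2 by nra.
  by have := mulr_ge0 (sqr_ge0 z) c0; lra.
apply: le_trans (ge0_ler_powR _ _ _ wz); rewrite ?nnegrE ?powR_ge0//; try lra.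
rewrite -powRrM; apply: le_trans (powR_bernoulli_ge _ _ _ w0 _); last by lra.
by rewrite le_eqVlt; apply/orP; left; apply/eqP; field.
Qed.

(** Bernoulli for (1+t)^(1-s) gives (1+t)^s >= (1+t) / (1+(1-s)t); clearing the denominator leaves
    the surplus s t ((1-s)t)^2. *)
Lemma powR_oneD_quad_ge (R : realType) (t s : R) : 0 <= t -> 0 <= s <= 1 ->
  1 + s * t * (1 - (1 - s) * t) <= (1 + t) `^ s.
Proof.
move=> t0 /andP[s0 s1]; have t1 : 0 < 1 + t by lra.
have c0 : 0 < 1 + (1 - s) * t by rewrite ltr_pwDl// mulr_ge0//; lra.
have Hb : (1 + t) `^ (1 - s) <= 1 + (1 - s) * t.
  by apply: le_trans (powR_bernoulli_le _ _ _ t1 _) _; [apply/andP; split; lra|lra].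
rewrite -(ler_pM2r c0).
have : 1 + t <= (1 + t) `^ s * (1 + (1 - s) * t).
  apply: le_trans (ler_wpM2l (powR_ge0 _ _) Hb).
  by rewrite -powRD ?(gt_eqF t1) ?implybT// subrKC powRr1 ?(ltW t1).
apply: le_trans; rewrite -subr_ge0.
rewrite [leRHS](_ : _ = s * t * ((1 - s) * t) ^+ 2); last by ring.
exact: mulr_ge0 (mulr_ge0 s0 t0) (sqr_ge0 _).
Qed.

(* The condition of [hardy_step_shift] at n + 1 for d = -1/5, divided by n, with
   x = 1/n and h = (1 + 1/n)^(1/3); cube roots make the case p = r = 1/3,
   where the inequality is tightest, polynomial. *)
Lemma shift_ineq (R : realType) (t u m h x p q r : R) :
  h = 1 + t -> x = h ^+ 3 - 1 -> x <= 1 ->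
  p = 1 / 3 + u -> q = 2 / 3 - u -> r = 1 / 3 - 5 / 4 * u + m ->
  0 <= t -> 0 <= u <= 1 / 6 -> u ^+ 2 <= m -> r <= p ->
  h `^ (3 * p) * (1 + (9 / 5 + 2 * r / q) * x) `^ q <=
  (1 + q + r) * x + h `^ (3 * r) * (1 - x / 5) `^ q.
Proof.
move=> hE xE x1 pE qE rE t0 u01 mu rp; have /andP[u0 u1] := u01.
have h0 : 0 < h by rewrite hE; lra.
have q0 : 0 < q by lra.
have p0 : 0 < p by lra.
have m0 : 0 <= m by apply: le_trans mu; exact: sqr_ge0.
have r0 : 0 <= r by lra.
have x0 : 0 <= x by rewrite xE subr_ge0 exprn_ege1// hE lerDl.
(* Since x <= 1, h^3 <= 2 < (63/50)^3. *)
have tT : t <= 13 / 50.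
  rewrite leNgt; apply/negP => tT; have : (63 / 50) ^+ 3 < h ^+ 3.
    by rewrite ltrXn2r// ?nnegrE hE; clear -tT t0; lra.
  by clear -xE x1; lra.
have h3p : h * (1 + 3 * u * t * (1 - (1 - 3 * u) * t)) <= h `^ (3 * p).
  have -> : 3 * p = 1 + 3 * u by rewrite pE; field.
  rewrite powRD ?(gt_eqF h0) ?implybT// powRr1 ?(ltW h0)// ler_wpM2l ?(ltW h0)//.
  rewrite hE; apply: powR_oneD_quad_ge => //; clear -u0 u1.
  by apply/andP; split; lra.
(* The exponent is 2 + 3m - 3u/4; ln h is bounded below by 1 - 1/h against 3m and above by t against
   3u/4. *)
have h3pr : h ^+ 2 - 3 / 4 * u * h ^+ 2 * t + 3 * m * h * t <= h `^ (3 * (p + r)).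
  have -> : 3 * (p + r) = 2%:R + (3 * m - 3 / 4 * u) by rewrite pE rE; field.
  rewrite powRD ?(gt_eqF h0) ?implybT// powR_mulrn ?(ltW h0)//.
  have -> : h ^+ 2 - 3 / 4 * u * h ^+ 2 * t + 3 * m * h * t =
      h ^+ 2 * (1 + (3 * m * (1 - h^-1) - 3 / 4 * u * t)).
    have -> : t = h - 1 by rewrite hE; ring.
    by clear -h0; field; rewrite gt_eqF.
  rewrite ler_wpM2l ?sqr_ge0//.
  apply: le_trans (powR_ge1Dln _ _ (3 * m - 3 / 4 * u) h0).
  rewrite lerD2l mulrBl lerB//.
    by rewrite ler_wpM2l ?mulr_ge0// ln_ge1BV.
  rewrite ler_wpM2l ?mulr_ge0// ?divr_ge0//; apply: le_trans (ln_leB1 _ _ h0) _.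
  by rewrite hE addrC addKr.
have xq : 1 - q * (x / 5 + x ^+ 2 / 80) <= (1 - x / 5) `^ q.
  apply: le_trans (powR_oneB_ge _ _ _ _ _).
  - by rewrite le_eqVlt; apply/orP; left; apply/eqP; clear; field.
  - by clear -x0 x1; apply/andP; split; lra.
  - by clear -u1 qE; lra.
set Y := 1 + _ * x.
have qY : q * Y = q + (9 / 5 * q + 2 * r) * x.
  by rewrite /Y; clear -q0; field; rewrite gt_eqF.
have Y0 : 0 <= Y.
  by rewrite addr_ge0// mulr_ge0// addr_ge0 ?divr_ge0 ?(mulr_ge0 _ r0) ?(ltW q0).
have pq : p + q = 1 by rewrite pE qE; field.
(* Multiplying the goal by h^(3p) turns its left side into ((1+x)^2)^p Y^q, whose AM-GM bound is
   polynomial. *)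
have amgm := powR_amgm2 _ _ _ _ _ (sqr_ge0 (1 + x)) Y0 p0 q0 pq.
have hx : ((1 + x) ^+ 2) `^ p = h `^ (3 * p) * h `^ (3 * p).
  rewrite -powRD ?(gt_eqF h0) ?implybT// xE addrCA subrr addr0 -exprM -powR_mulrn ?(ltW h0)//.
  by rewrite -powRrM; congr (_ `^ _); ring.
have hp0 : 0 < h `^ (3 * p) by rewrite powR_gt0.
rewrite -(ler_pM2l hp0) mulrA -hx; apply: (le_trans amgm).
have -> : h `^ (3 * p) * ((1 + q + r) * x + h `^ (3 * r) * (1 - x / 5) `^ q) =
    (1 + q + r) * x * h `^ (3 * p) + (1 - x / 5) `^ q * h `^ (3 * (p + r)).
  by rewrite (mulrDr 3) powRD ?(gt_eqF h0) ?implybT//; clear; ring.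
have b0 : 0 <= 1 - q * (x / 5 + x ^+ 2 / 80).
  have qq : q <= 1 by clear -qE u0; lra.
  have xx : x / 5 + x ^+ 2 / 80 <= 1 by clear -x0 x1; nra.
  have xx0 : 0 <= x / 5 + x ^+ 2 / 80 by rewrite addr_ge0 ?divr_ge0 ?sqr_ge0.
  by rewrite subr_ge0 -[leRHS](mulr1 1) ler_pM// ltW.
have c0 : 0 <= h ^+ 2 - 3 / 4 * u * h ^+ 2 * t + 3 * m * h * t.
  rewrite addr_ge0//; last by rewrite !mulr_ge0// (ltW h0).
  have -> : h ^+ 2 - 3 / 4 * u * h ^+ 2 * t = h ^+ 2 * (1 - 3 / 4 * (u * t)).
    by clear; ring.
  have ut : u * t <= 1 / 6 * (13 / 50) by exact: ler_pM.
  by rewrite mulr_ge0 ?sqr_ge0//; move: ut; clear; lra.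
have H1 : (1 + q + r) * x * (h * (1 + 3 * u * t * (1 - (1 - 3 * u) * t))) <=
    (1 + q + r) * x * h `^ (3 * p).
  by rewrite ler_wpM2l// mulr_ge0// !addr_ge0 ?(ltW q0).
apply: le_trans (lerD H1 (ler_pM b0 c0 xq h3pr)).
have t01 : 0 <= t <= 13 / 50 by rewrite t0.
have := shift_poly_le _ t u m t01 u01 mu; rewrite qY -hE -xE -qE -pE -rE.
have -> : 2 - 9 / 4 * u + m = 1 + q + r by rewrite qE rE; field.
apply: le_trans; clear.
by rewrite le_eqVlt; apply/orP; left; apply/eqP; ring.
Qed.

(** 3 >= (41/40)^44 and ln (41/40) >= 1 - 40/41 = 1/41. *)
Lemma ln3_ge (R : realType) : 44 / 41 <= ln (3 : R).
Proof.
have b0 : (0 : R) < 41 / 40 by lra.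
have : (41 / 40) ^+ 44 <= (3 : R).
  rewrite (exprM _ 11 4).
  have b11 : (41 / 40) ^+ 11 <= (21 / 16 : R) by lra.
  apply: le_trans (_ : (21 / 16) ^+ 4 <= _); last by lra.
  by rewrite lerXn2r ?nnegrE; lra.
rewrite -ler_ln ?posrE ?exprn_gt0// lnXn// => H3; apply: le_trans H3.
have := ln_ge1BV _ _ b0; rewrite invf_div -[ln _ *+ _]mulr_natr => H.
have : (1 - 40 / 41) * 44 <= ln (41 / 40 : R) * 44 by rewrite ler_wpM2r.
by lra.
Qed.

(** The condition [first] for d = -1/5. Multiplying by 3^p and applying AM-GM leaves an inequality
    linear in r; as 3^p <= 2, its worst case is r = p, where it reads 2 3^p >= 9/5 + 16p/5. *)
Lemma shift_ineq_first (R : realType) (p r : R) :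
  1 / 3 <= p <= 1 / 2 -> 0 <= r -> r <= p ->
  (9 / 5 + 2 * r / (1 - p)) `^ (1 - p) <= 2 - p + r.
Proof.
move=> /andP[p3 p2] r0 rp.
have q0 : 0 < 1 - p by lra.
have p0 : 0 < p by lra.
have three : (0 : R) < 3 by [].
have T0 : (0 : R) < 3 `^ p by rewrite powR_gt0.
have T2 : (3 : R) `^ p <= 2.
  apply: le_trans (powR_bernoulli_le _ _ p three _) _; last by lra.
  by apply/andP; split; lra.
(* 212 / 147 is just below the cube root of 3. *)
have Tge : 212 / 147 * (1 + 44 / 41 * (p - 1 / 3)) <= (3 : R) `^ p.
  have -> : (3 : R) `^ p = 3 `^ (1 / 3) * 3 `^ (p - 1 / 3).
    by rewrite -powRD ?(gt_eqF three) ?implybT// subrKC.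
  apply: ler_pM; [lra|lra| |].
  - rewrite [leLHS](_ : _ = ((212 / 147) `^ 3%:R) `^ (1 / 3)); last first.
      have e1 : 3%:R * (1 / 3) = 1 :> R by field.
      by rewrite -powRrM e1 powRr1; lra.
    apply: ge0_ler_powR; rewrite ?nnegrE ?powR_ge0 ?powR_mulrn; lra.
  - apply: le_trans (powR_ge1Dln _ _ _ three).
    by rewrite lerD2l mulrC ler_wpM2l ?ln3_ge//; lra.
have V0 : 0 <= 9 / 5 + 2 * r / (1 - p) by rewrite addr_ge0 ?divr_ge0 ?mulr_ge0// ltW.
have := powR_amgm2 _ 3 _ _ _ (ler0n _ 3) V0 p0 q0 (subrKC p 1).
have -> : (1 - p) * (9 / 5 + 2 * r / (1 - p)) = (1 - p) * (9 / 5) + 2 * r.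
  by field; rewrite gt_eqF.
move=> H; rewrite -(ler_pM2l T0); apply: le_trans H _.
have := mulr_ge0 (_ : 0 <= p - r) (_ : 0 <= 2 - 3 `^ p).
by rewrite !subr_ge0 => /(_ rp T2); move: (3 `^ p) T0 T2 Tge => T; lra.
Qed.

Lemma hardy_step_critical (R : realType) (p r : R) :
  p <= 1 / 2 -> 0 < r -> r <= p -> (1 - p) ^+ 2 <= r * (1 + p) ->
  hardy_step p r (c_pr p r)^-1.
Proof.
move=> p2 r0 rp crit.
have p3 : 1 / 3 <= p by nra.
(* The line r = 1/3 - 5u/4 is tangent to the curve (1-p)^2 = r (1+p) at p = r = 1/3. So m is the
   excess over the tangent, and [crit] gives (1+p)(m - u^2) >= u^2 (11/12 - u). *)
pose u := p - 1 / 3; pose m := r - (1 / 3 - 5 / 4 * u).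
have q0 : 0 < 1 - p by lra.
have u01 : 0 <= u <= 1 / 6 by apply/andP; rewrite /u; split; lra.
have mu : u ^+ 2 <= m.
  rewrite -subr_ge0 /m /u; have p10 : 0 < 1 + p by lra.
  rewrite -(pmulr_lge0 _ p10).
  have : 0 <= (p - 1 / 3) ^+ 2 * (1 - 1 / 12 - (p - 1 / 3)).
    by rewrite mulr_ge0 ?sqr_ge0//; lra.
  by lra.
set k := (1 - p + 2 * r) / (1 - p).
have kE : k = 1 + 2 * r / (1 - p) by rewrite /k; field; rewrite gt_eqF.
apply: (hardy_step_shift _ p r (- (1 / 5))); rewrite -/k; try lra.
  have -> : k + 1 + - (1 / 5) = 9 / 5 + 2 * r / (1 - p).
    by rewrite kE; move: (2 * r / _) => ?; field.
  by apply: shift_ineq_first => //; [apply/andP; split|exact: ltW].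
move=> n; set N := n.+2%:R; set M := n.+1%:R.
have NE : N = M + 1 by rewrite /N -natr1.
have M1 : 1 <= M by rewrite ler1n.
clearbody N M.
have M0 : 0 < M by lra.
have N0 : 0 < N by lra.
pose h := (N / M) `^ (1 / 3).
have h0 : 0 <= h by exact: powR_ge0.
have hX s : h `^ (3 * s) = (N / M) `^ s.
  by rewrite -powRrM; congr (_ `^ _); field.
have h3 : h ^+ 3 = N / M.
  have -> : h ^+ 3 = h `^ (3 * 1) by rewrite mulr1 -powR_mulrn.
  by rewrite hX powRr1// divr_ge0 ?ltW.
have NM : N / M - 1 = M^-1 by rewrite NE; field; rewrite gt_eqF.
have Mi : M^-1 <= 1 by rewrite invf_le1.
have Mi0 : 0 < M^-1 by rewrite invr_gt0.
have h1 : 1 <= h.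
  rewrite leNgt; apply/negP => hlt.
  have : h ^+ 3 < 1 by rewrite exprn_ilt1.
  by rewrite h3; lra.
have x1 : M^-1 = h ^+ 3 - 1 by rewrite h3 NM.
have pE : p = 1 / 3 + u by rewrite /u; ring.
have qE : 1 - p = 2 / 3 - u by rewrite /u; field.
have rE : r = 1 / 3 - 5 / 4 * u + m by rewrite /m; ring.
have h10 : 0 <= h - 1 by rewrite subr_ge0.
have := shift_ineq _ _ u m h M^-1 p (1 - p) r (esym (subrKC 1 h)) x1 Mi pE qE rE h10 u01 mu rp.
set Z := k + N + _; set W := M + _.
have -> : 1 + (9 / 5 + 2 * r / (1 - p)) * M^-1 = Z / M.
  rewrite /Z NE kE; move: (2 * r / _) => ?; field.
  by rewrite gt_eqF.
have -> : 1 - M^-1 / 5 = W / M by rewrite /W; field; rewrite gt_eqF.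
have Z0 : 0 <= Z.
  have : 0 <= k by rewrite /k divr_ge0//; lra.
  by rewrite /Z NE; lra.
have W0 : 0 <= W by rewrite /W; lra.
rewrite !hX !powR_div ?(ltW N0)// => /(ler_wpM2l (ltW M0)).
have Ms0 s : M `^ s != 0 by rewrite gt_eqF// powR_gt0.
have Mpq : M `^ p * M `^ (1 - p) = M.
  by rewrite -powRD ?(gt_eqF M0) ?implybT// subrKC powRr1 ?(ltW M0).
have Mpr : M `^ (p - r) * M `^ r = M `^ p.
  by rewrite -powRD ?(gt_eqF M0) ?implybT// subrK.
have -> : M * (N `^ p / M `^ p * (Z `^ (1 - p) / M `^ (1 - p))) = N `^ p * Z `^ (1 - p).
  by rewrite -{1}Mpq; field; rewrite !Ms0.
move=> /le_trans; apply.
rewrite mulrDr le_eqVlt; apply/orP; left; apply/eqP; congr (_ + _).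
  by rewrite mulrCA divff ?gt_eqF//; ring.
by rewrite -{1}Mpq -{1}Mpr; field; rewrite !Ms0.
Qed.

(** * Lowering the exponent, and the step for all p *)

Lemma hardy_step_le (R : realType) (p r C C' : R) :
  C <= C' -> hardy_step p r C -> hardy_step p r C'.
Proof.
move=> CC' [s s0 H]; exists s => // n A B B0 BA; apply: le_trans (H n A B B0 BA) _.
by rewrite ler_wpM2r ?powR_ge0// lerD2r ler_wpM2r// invr_ge0 powR_ge0.
Qed.

(* Apply the step for p0 to A^(p/p0) and B^(p/p0). *)
Lemma hardy_step_lower_exponent (R : realType) (p p0 r C : R) :
  0 < p -> p < p0 -> 0 < C -> hardy_step p0 r C ->
  hardy_step p r ((p0 / p) `^ p * C `^ (p / p0)).
Proof.
move=> p_gt0 pp0 C0 [s [s0 s00] H].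
have p00 : 0 < p0 by exact: lt_trans pp0.
pose g := p / p0.
have g0 : 0 < g by rewrite divr_gt0.
have g1 : 0 < 1 - g by rewrite subr_gt0 ltr_pdivrMr// mul1r.
have gp0 : g * p0 = p by rewrite /g divfK// gt_eqF.
have gV : p0 / p = g^-1 by rewrite /g invf_div.
rewrite -/g gV; set K := _ * _.
have K0 : 0 <= K by rewrite mulr_ge0 ?powR_ge0.
exists (fun n => K * g / C * s n).
  split=> [n|]; last by rewrite s00 mulr0.
  by rewrite mulr_ge0// divr_ge0 ?(ltW C0)// mulr_ge0// ltW.
move=> n A B B0 BA; have A0 : 0 <= A by exact: le_trans BA.
set N : R := n.+1%:R; have N0 : 0 < N by rewrite /N ltr0n.
have Nr : 0 < N `^ r by rewrite powR_gt0.
pose b := A `^ g - B `^ g.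
have b0 : 0 <= b by rewrite subr_ge0 ge0_ler_powR ?nnegrE// ltW.
(* This is AM-GM in the form B^g A^(1-g) <= g B + (1-g) A. *)
have bA : A - B <= g^-1 * (b * A `^ (1 - g)).
  rewrite mulrC ler_pdivlMr// /b !mulrBl.
  have -> : A `^ g * A `^ (1 - g) = A.
    by rewrite -powRD subrKC ?oner_eq0// powRr1.
  have := powR_amgm2 _ _ _ _ _ B0 A0 g0 g1 (subrKC g 1).
  by lra.
have := H n (A `^ g) (B `^ g) (powR_ge0 _ _).
rewrite -!powRrM gp0 -/N -/b => /(_ _) HX.
have {HX} HX : N `^ (p0 - r) * b `^ p0 <=
    (C / N `^ r + s n) * A `^ p - s n.+1 * B `^ p.
  by rewrite lerBrDr HX// ge0_ler_powR ?nnegrE// ltW.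
set X := N `^ (p0 - r) * b `^ p0 in HX.
have X0 : 0 <= X by rewrite mulr_ge0 ?powR_ge0.
pose D := A `^ p / N `^ r.
have D0 : 0 <= D by rewrite divr_ge0 ?powR_ge0.
have XD : N `^ (p - r) * (A - B) `^ p <= K * ((X / C) `^ g * D `^ (1 - g)).
  apply: (@le_trans _ _ (N `^ (p - r) * (g^-1 * (b * A `^ (1 - g))) `^ p)).
    by rewrite ler_wpM2l ?powR_ge0// ge0_ler_powR ?nnegrE ?subr_ge0 ?(ltW p_gt0)//;
      apply: le_trans bA; rewrite subr_ge0.
  have -> : (X / C) `^ g = N `^ ((p0 - r) * g) * b `^ p / C `^ g.
    by rewrite powR_div// powRM ?powR_ge0// -!powRrM (mulrC p0) gp0.
  have -> : D `^ (1 - g) = A `^ (p * (1 - g)) / N `^ (r * (1 - g)).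
    by rewrite powR_div ?powR_ge0// -!powRrM.
  rewrite !powRM ?mulr_ge0 ?powR_ge0 ?invr_ge0 ?(ltW g0)// -powRrM.
  have -> : N `^ (p - r) = N `^ ((p0 - r) * g) / N `^ (r * (1 - g)).
    rewrite -powRB ?(gt_eqF N0) ?implybT//; congr (_ `^ _).
    by rewrite mulrBl (mulrC p0) gp0; ring.
  rewrite le_eqVlt; apply/orP; left; apply/eqP.
  by rewrite /K (mulrC (1 - g) p); field; rewrite !gt_eqF// powR_gt0.
(* Young's inequality gives X the weight K g / C, hence the scaling of s; the D-terms K g D and K
   (1-g) D add up to K D. *)
have Y := powR_amgm2 _ (X / C) D g (1 - g) (divr_ge0 X0 (ltW C0)) D0 g0 g1 (subrKC g 1).
rewrite -lerBrDr; apply: le_trans XD _; apply: le_trans (ler_wpM2l K0 Y) _.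
have HK : K * (g / C) * X <= K * (g / C) * ((C / N `^ r + s n) * A `^ p - s n.+1 * B `^ p).
  by rewrite ler_wpM2l// mulr_ge0// divr_ge0 ?(ltW C0) ?(ltW g0).
rewrite [leLHS](_ : _ = K * (g / C) * X + K * (1 - g) * D); last by ring.
apply: le_trans (lerD HK (lexx _)) _.
rewrite le_eqVlt; apply/orP; left; apply/eqP.
by rewrite /D; field; rewrite !gt_eqF.
Qed.

(** AM-GM with weights p and 1-p, whose mean is (1-r) + (1-p+2r) = 2 - p + r. *)
Lemma c_pr_inv_ge (R : realType) (p r : R) : 0 < p -> p < 1 -> 0 < r -> r < 1 ->
  ((1 - r) / p) `^ p <= (c_pr p r)^-1.
Proof.
move=> p0 p1 r0 r1; have q0 : 0 < 1 - p by lra.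
have k0 : 0 < (1 - p + 2 * r) / (1 - p) by rewrite divr_gt0//; lra.
have u0 : 0 <= (1 - r) / p by rewrite divr_ge0//; lra.
rewrite c_pr_invE// ler_pdivlMr ?powR_gt0//.
apply: le_trans (powR_amgm2 _ _ _ _ _ u0 (ltW k0) p0 q0 (subrKC p 1)) _.
rewrite (mulrC p) (mulrC (1 - p)) !divfK ?gt_eqF//; lra.
Qed.

Lemma hardy_step_c_pr (R : realType) (p r : R) :
  0 < p -> p < 1 -> 0 < r -> r <= p -> hardy_step p r (c_pr p r)^-1.
Proof.
move=> p0 p1 r0 rp.
have critical (s : R) : s < 1 -> r <= s -> (1 - s) ^+ 2 <= r * (1 + s) ->
    hardy_step s r (c_pr s r)^-1.
  move=> s1 rs crit; have [s2|s2] := leP (2^-1) s.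
    exact: hardy_step_half.
  by apply: hardy_step_critical => //; lra.
have [crit|crit] := leP ((1 - p) ^+ 2) (r * (1 + p)); first exact: critical.
(* d^2 is the discriminant of s^2 - (2+r) s + 1 - r, the critical equation in s; the smaller root is
   taken. *)
pose d := Num.sqrt (r ^+ 2 + 8 * r).
have d2 : d ^+ 2 = r ^+ 2 + 8 * r by rewrite sqr_sqrtr// addr_ge0 ?sqr_ge0 ?mulr_ge0 ?ltW.
have d0 : 0 <= d by exact: sqrtr_ge0.
pose s := (2 + r - d) / 2.
have sE : (1 - s) ^+ 2 = r * (1 + s).
  have -> : (1 - s) ^+ 2 = r * (1 + s) + (d ^+ 2 - (r ^+ 2 + 8 * r)) / 4.
    by rewrite /s; field.
  by rewrite d2 subrr mul0r addr0.
have rd : r < d by rewrite -(@ltr_pXn2r _ 2) ?nnegrE ?(ltW r0)// d2; lra.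
have s1 : s < 1 by rewrite /s; lra.
have ps : p < s.
  (* The squares differ by 4 ((1-p)^2 - r (1+p)) > 0. *)
  have : d < 2 + r - 2 * p.
    rewrite -(@ltr_pXn2r _ 2) ?nnegrE//; last by lra.
    by rewrite d2; lra.
  by rewrite /s; lra.
clearbody s; have s0 : 0 < s by lra.
pose k := (3 - s) / (1 + s).
have k0 : 0 < k by rewrite divr_gt0//; lra.
have rE : r = (1 - s) ^+ 2 / (1 + s) by rewrite sE mulfK// gt_eqF//; lra.
(* At p = s, the AM-GM inequality behind [c_pr_inv_ge] is an equality. *)
have cE : (c_pr s r)^-1 = k `^ s.
  rewrite c_pr_invE//.
  have -> : (1 - s + 2 * r) / (1 - s) = k.
    by rewrite rE /k; field; rewrite !gt_eqF//; lra.
  have -> : 2 - s + r = k by rewrite rE /k; field; rewrite gt_eqF//; lra.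
  rewrite -{1}[k]powRr1 ?(ltW k0)// -powRB ?(gt_eqF k0) ?implybT//.
  by congr (_ `^ _); ring.
apply: hardy_step_le (c_pr_inv_ge _ _ _ p0 p1 r0 _) _; first by lra.
(* On the critical curve 1 - r = s k. *)
have -> : ((1 - r) / p) `^ p = (s / p) `^ p * (k `^ s) `^ (p / s).
  rewrite -powRrM mulrCA divff ?gt_eqF// mulr1 -powRM ?(divr_ge0 (ltW s0) (ltW p0)) ?(ltW k0)//.
  by congr (_ `^ _); rewrite rE /k; field; rewrite !gt_eqF//; lra.
apply: hardy_step_lower_exponent => //; first by rewrite powR_gt0.
by rewrite -cE; apply: critical => //; [lra|rewrite sE].
Qed.

(** * Summation and passage to infinite series *)

(** The leftover s_n A_(n+1)^p is the extra term on the right of the next step, so the weights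
    cancel along the induction. *)
Lemma hardy_step_partial_sum (R : realType) (p r C : R) (s a A : nat -> R) :
  (forall n (x y : R), 0 <= y -> y <= x ->
      n.+1%:R `^ (p - r) * (x - y) `^ p + s n.+1 * y `^ p
        <= (C / n.+1%:R `^ r + s n) * x `^ p) ->
  s 0%N = 0 -> (forall n, 0 <= A n.+1) -> (forall n, 0 <= a n.+1) ->
  (forall n, A n.+1 = a n.+1 + A n.+2) -> forall n,
  \sum_(1 <= i < n.+1) i%:R `^ (p - r) * a i `^ p + s n * A n.+1 `^ p
    <= C * \sum_(1 <= i < n.+1) A i `^ p / i%:R `^ r.
Proof.
move=> step s0 A0 a0 AE; elim=> [|n IH].
  by rewrite !big_geq// s0 mul0r mulr0 addr0.
rewrite (@big_nat_recr _ _ _ n.+1)//= [in leRHS](@big_nat_recr _ _ _ n.+1)//= mulrDr.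
have A12 : A n.+2 <= A n.+1 by rewrite (AE n) lerDr.
have Aa : A n.+1 - A n.+2 = a n.+1 by rewrite AE addrK.
have := step n _ _ (A0 n.+1) A12; rewrite Aa; lra.
Qed.

Theorem theorem1p4 (R : realType) (p r : R)
    (hp0 : 0 < p) (hp1 : p < 1) (hr0 : 0 < r) (hrp : r <= p)
    (a : nat -> R) (ha : forall n : nat, (1 <= n)%N -> 0 <= a n) :
  (\sum_(1 <= n <oo)
      ((n%:R `^ r)^-1)%:E * (poweR (\sum_(n <= k <oo) (a k)%:E) p)
   >= (c_pr p r)%:E *
      \sum_(1 <= n <oo) (a n `^ p / n%:R `^ (r - p))%:E)%E.
Proof.
have c0 := c_pr_gt0 _ p r hp1 hr0.
have tail0 n : (1 <= n)%N -> (0 <= \sum_(n <= k <oo) (a k)%:E)%E.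
  by move=> n1; apply: nneseries_ge0 => k nk _; rewrite lee_fin ha// (leq_trans n1).
have term0 n : (1 <= n)%N -> (0 <= ((n%:R `^ r)^-1)%:E * poweR (\sum_(n <= k <oo) (a k)%:E) p)%E.
  by move=> n1; rewrite mule_ge0 ?poweR_ge0// lee_fin invr_ge0 powR_ge0.
have recl n : (1 <= n)%N -> (\sum_(n <= k <oo) (a k)%:E = (a n)%:E + \sum_(n.+1 <= k <oo) (a k)%:E)%E.
  move=> n1; rewrite (nneseries_split n 1); last first.
    by move=> k nk; rewrite lee_fin ha// (leq_trans n1).
  by rewrite addn1 big_nat1.
(* If the first tail is infinite, the term n = 1 alone makes the left-hand series infinite. *)
have [Ay|Afin] := eqVneq (\sum_(1 <= k <oo) (a k)%:E)%E +oo%E.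
  apply: le_trans (nneseries_lim_ge 2 _) => [|n n1 _]; last exact: term0.
  by rewrite big_nat1 powR1 invr1 mul1e Ay poweRyr ?gt_eqF// leey.
have fin n : (1 <= n)%N -> (\sum_(n <= k <oo) (a k)%:E)%E \is a fin_num.
  elim: n => // -[_ _|n IH _]; first by rewrite ge0_fin_numE ?tail0// ltey.
  have := IH isT; rewrite recl// fin_numD => /andP[_ +].
  by [].
pose A n := fine (\sum_(n <= k <oo) (a k)%:E)%E.
have AE n : (1 <= n)%N -> (\sum_(n <= k <oo) (a k)%:E)%E = (A n)%:E.
  by move=> n1; rewrite /A fineK// fin.
have [s [s0 s00] step] := hardy_step_c_pr _ p r hp0 hp1 hr0 hrp.
have partial := hardy_step_partial_sum _ p r _ s a A step s00 _ _ _.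
rewrite -nneseriesZl; last by move=> n _; rewrite lee_fin divr_ge0 ?powR_ge0.
(* It suffices to bound each partial sum of the series in a_n. *)
apply: lime_le.
  apply: is_cvg_nneseries => n n1 _.
  by rewrite mule_ge0 ?lee_fin ?divr_ge0 ?powR_ge0 ?(ltW c0).
apply: nearW => -[|n].
  rewrite big_geq//; apply: nneseries_ge0 => n n1 _; exact: term0.
apply: le_trans (nneseries_lim_ge n.+1 _) => [|m m1 _]; last exact: term0.
rewrite [leRHS](_ : _ = (\sum_(1 <= i < n.+1) A i `^ p / i%:R `^ r)%:E); last first.
  rewrite -sumEFin big_seq [RHS]big_seq; apply: eq_bigr => i.
  rewrite mem_index_iota => /andP[i1 _].
  by rewrite AE// poweR_EFin -EFinM mulrC.
under eq_bigr do rewrite -EFinM.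
rewrite sumEFin lee_fin -mulr_sumr -ler_pdivlMl//.
apply: le_trans (partial _ _ _ n).
(* The leftover weight term is nonnegative and is dropped. *)
- rewrite (eq_bigr (fun i => i%:R `^ (p - r) * a i `^ p)); last first.
    by move=> i _; rewrite -opprB powRN invrK mulrC.
  by rewrite lerDl mulr_ge0 ?powR_ge0.
- by move=> m; rewrite fine_ge0// tail0.
- by move=> m; rewrite ha.
- by move=> m; apply: EFin_inj; rewrite EFinD -!AE// recl.
Qed.
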